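(* Let $H$ be a graph with $\chi(H)=r\ge 3$ and let $v(H)$ denote its number of vertices. Then $$\delta_{\mathrm{VC}}(H)\ \ge\ \frac{(r-3)(v(H)-1)+1}{(r-2)(v(H)-1)+1}\ >\ \frac{r-3}{r-2}.$$
   Context: All graphs are finite and simple. A graph is $H$-free if it contains no (not necessarily induced) subgraph isomorphic to $H$; it is maximal $H$-free if it is $H$-free and adding any missing edge creates a copy of $H$. $\delta(G)$ denotes minimum degree and $\chi$ the chromatic number. The VC-dimension $\mathrm{VC}(G)$ of a graph $G$ is the VC-dimension of the set system $\{N_G(v):v\in V(G)\}$ on $V(G)$, i.e. the maximum size of a set $S\subseteq V(G)$ such that $\{N_G(v)\cap S: v\in V(G)\}=2^S$. The VC-dimension threshold $\delta_{\mathrm{VC}}(H)$ is the infimum of all $\gamma\ge 0$ for which there exists a constant $C=C(\gamma,H)$ such that every maximal $H$-free graph $G$ with $\delta(G)\ge\gamma|V(G)|$ satisfies $\mathrm{VC}(G)\le C$. *)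

(* Defs.v *)
From HB Require Import structures.
From mathcomp Require Import all_boot all_order all_algebra.
From mathcomp Require Import boolp classical_sets reals.

Set Implicit Arguments.
Unset Strict Implicit.
Unset Printing Implicit Defensive.

Record sgraph := SGraph {
  vertex :> finType;
  adj : rel vertex;
  adj_sym : symmetric adj;
  adj_irr : irreflexive adj }.

Definition neigh (G : sgraph) (v : G) : {set G} := [set u | adj v u]%SET.

(* Degrees are smaller than #|G|, so the default value #|G| only matters for
   the graph without vertices. *)
Definition min_degree (G : sgraph) : nat :=
  \big[minn/#|G|]_(v : G) #|neigh v|.

Definition colorable (G : sgraph) (k : nat) : bool :=
  [exists c : {ffun G -> 'I_k}, forall x, forall y, adj x y ==> (c x != c y)].

Lemma colorable_card (G : sgraph) : colorable G #|G|.
Proof.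
apply/existsP; exists (finfun (@enum_rank G)).
apply/forallP => x; apply/forallP => y; apply/implyP => xy.
rewrite !ffunE; apply/eqP => /enum_rank_inj exy.
by rewrite exy adj_irr in xy.
Qed.

Definition chromatic_number (G : sgraph) : nat :=
  ex_minn (ex_intro (colorable G) #|G| (colorable_card G)).

Definition contains (G H : sgraph) : Prop :=
  exists2 f : H -> G, injective f & forall x y, adj x y -> adj (f x) (f y).

Definition subgraph_free (H G : sgraph) : Prop := ~ contains G H.

Section AddEdge.
Variables (G : sgraph) (x y : G).

(* The test u != v is redundant when x != y; it keeps the graph loopless for
   arbitrary x and y. *)
Definition add_edge_rel : rel G :=
  fun u v => adj u v || ((u != v) && ([set u; v] == [set x; y])%SET).

Lemma add_edge_sym : symmetric add_edge_rel.
Proof. by move=> u v; rewrite /add_edge_rel adj_sym eq_sym finset.setUC. Qed.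

Lemma add_edge_irr : irreflexive add_edge_rel.
Proof. by move=> u; rewrite /add_edge_rel adj_irr eqxx. Qed.

Definition add_edge : sgraph := SGraph add_edge_sym add_edge_irr.
End AddEdge.

Definition maximal_free (H G : sgraph) : Prop :=
  subgraph_free H G /\
  forall x y : G, x != y -> ~~ adj x y -> contains (add_edge x y) H.

Definition shattered (G : sgraph) (S : {set G}) : bool :=
  ([set neigh v :&: S | v : G] == powerset S)%SET.

(* The graph without vertices shatters no set; its VC-dimension is 0 here. *)
Definition VC (G : sgraph) : nat := \max_(S : {set G} | shattered S) #|S|.

Import Order.TTheory GRing.Theory Num.Theory.
Local Open Scope ring_scope.
Local Open Scope classical_set_scope.

Definition VC_bounding (R : realType) (H : sgraph) : set R :=
  [set gamma : R | 0 <= gamma /\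
     exists C : nat, forall G : sgraph, maximal_free H G ->
       gamma * #|G|%:R <= (min_degree G)%:R -> (VC G <= C)%N].
Arguments VC_bounding : clear implicits.

Definition delta_VC (R : realType) (H : sgraph) : R := inf (VC_bounding R H).

Lemma min_degree_lt (G : sgraph) (v : G) : (min_degree G < #|G|)%N.
Proof.
apply: (@leq_ltn_trans #|neigh v|).
  rewrite /min_degree.
  elim: (index_enum G) (mem_index_enum v) => // a s IH.
  rewrite inE big_cons => /orP[/eqP <-|/IH h]; first exact: geq_minl.
  exact: leq_trans (geq_minr _ _) h.
rewrite -cardsT; apply: proper_card; rewrite properT.
by apply/eqP => /setP/(_ v); rewrite !inE adj_irr.
Qed.

(* Hence the infimum defining delta_VC is never the junk value of inf. *)
Lemma has_inf_VC_bounding (R : realType) (H : sgraph) :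
  has_inf (VC_bounding R H).
Proof.
split; last by exists 0 => g [].
exists 1; split; first exact: ler01.
exists 0%N => G _; rewrite mul1r ler_nat => GM.
apply/bigmax_leqP => S _; case: (set_0Vmem S) => [->|[v _]].
  by rewrite cards0.
by have := min_degree_lt v; rewrite ltnNge GM.
Qed.

(* Main.v *)
Require Import Defs.
From mathcomp Require Import all_boot all_order all_algebra.
From mathcomp Require Import boolp reals zify ring lra.

(* For every [gamma < q] and every [C] we build a maximal [H]-free graph of
   relative minimum degree at least [gamma] and VC-dimension above [C].

   Write [h] for the number of vertices of [H].  Delete [r - 3] independent
   sets from [H] so that the remaining graph [K] has the largest possible odd
   girth [g], and let [U] be a smallest vertex set, over all such choices,
   whose deletion from [K] pushes the odd girth beyond [g].  Fix [u] in [U].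
   The core of the construction has one copy of each vertex of [U] other than
   [u], copies [s < d] of [u], and one copy of [K - U] for each map [v] from
   ['I_d] to [H]; the copy [s] of [u] is joined in the copy [v] of [K - U] to
   the single vertex [v s].  The core maps homomorphically to [K], and a closed
   walk of length [g] avoiding the copies of [U - u] would pass through exactly
   one [s], stay inside one copy [v], and meet both edges at [s] in the same
   vertex [v s], contradicting injectivity of its image.  Hence, by minimality
   of [U], the join of the core with a complete [(r - 3)]-partite graph is
   [H]-free.  Linear degrees in the core come from [h] further independent sets
   of size [m], attached so that every closed walk of length [g] avoids them;
   the parts of the complete multipartite graph have size [(h - 1) m].

   Extend the result to a maximal [H]-free graph.  For each [v] and [s], the
   copy [s] of [u] must miss one of the copies [(v, x)] of a neighbour [x] of
   [u], as otherwise [H] appears, but it sees [(v, v s)].  By the Sauer-Shelah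
   lemma, bounded VC-dimension leaves polynomially many traces on the copies of
   [u] for each [x], and each combination of traces is compatible with at most
   [(h - 1) ^ d] maps [v]; this is less than [h ^ d] for large [d]. *)

Set Implicit Arguments.
Unset Strict Implicit.
Unset Printing Implicit Defensive.

(** * Shattering and counting *)

Definition shatters (T : finType) (F : {set {set T}}) (A : {set T}) :=
  [forall (B : {set T} | B \subset A), exists (X | X \in F), X :&: A == B].

Lemma shattersP (T : finType) (F : {set {set T}}) (A : {set T}) :
  reflect (forall B : {set T}, B \subset A ->
             exists2 X, X \in F & X :&: A = B)
          (shatters F A).
Proof.
apply: (iffP forall_inP) => h B /h.
  by case/exists_inP => X XF /eqP; exists X.
by case=> X XF XA; apply/exists_inP; exists X => //; apply/eqP.
Qed.

(* Pajor's form of the Sauer-Shelah lemma. *)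
Lemma card_le_shatters (T : finType) (D : {set T}) (F : {set {set T}}) :
  (forall X, X \in F -> X \subset D) ->
  #|F| <= #|[set A : {set T} | shatters F A]|.
Proof.
have [n] := ubnP #|D|; elim: n D F => // n IHn D F ltDn FD.
case: (set_0Vmem D) => [D0|[x xD]].
  have FS : F \subset [set set0].
    by apply/subsetP=> X /FD; rewrite D0 subset0 inE.
  case: (set_0Vmem F) => [->|[X XF]]; first by rewrite cards0.
  apply: leq_trans (subset_leq_card FS) _; rewrite cards1.
  apply/card_gt0P; exists set0; rewrite inE; apply/shattersP => B.
  by rewrite subset0 => /eqP ->; exists X => //; rewrite setI0.
(* [F1] holds the members containing [x], with [x] removed. A set shattered by both families remains
   shattered by [F] after adding [x]. *)
pose F0 := [set X in F | x \notin X].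
pose F1 := [set X : {set T} | (x \notin X) && (x |: X \in F)].
have cF : #|F| = #|F0| + #|F1|.
  rewrite -(cardsID [set X : {set T} | x \notin X] F); congr (_ + _).
    by apply: eq_card => X; rewrite !inE.
  have <- : [set X :\ x | X in F :\: [set Y : {set T} | x \notin Y]] = F1.
    apply/setP => X; rewrite inE; apply/imsetP/andP.
      case=> Y; rewrite !inE negbK => /andP[xY YF] ->.
      by rewrite setD11 setD1K.
    case=> xX XF; exists (x |: X); first by rewrite !inE XF eqxx.
    by rewrite setU1K.
  rewrite card_in_imset // => X Y; rewrite !inE !negbK.
  by move=> /andP[xX _] /andP[xY _] e; rewrite -(setD1K xX) e setD1K.
have ltD : #|D :\ x| < n.
  by move: ltDn; rewrite (cardsD1 x) xD ltnS.
have := IHn (D :\ x) F0 ltD; have := IHn (D :\ x) F1 ltD.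
set S0 := [set A | shatters F0 A]; set S1 := [set A | shatters F1 A].
have h1 X : X \in F1 -> X \subset D :\ x.
  rewrite inE => /andP[xX /FD /subsetP XD]; apply/subsetP => y yX.
  rewrite !inE XD ?inE ?yX ?orbT // andbT.
  by apply: contraNneq xX => <-.
have h0 X : X \in F0 -> X \subset D :\ x.
  rewrite inE => /andP[/FD /subsetP XD xX]; apply/subsetP => y yX.
  by rewrite !inE XD // andbT; apply: contraNneq xX => <-.
move=> /(_ h1) c1 /(_ h0) c0.
apply: leq_trans (_ : #|S0 :|: S1| + #|S0 :&: S1| <= _).
  by rewrite cF cardsUI leq_add.
have xN A : A \in S0 :|: S1 -> x \notin A.
  rewrite !inE => /orP[] /shattersP/(_ A (subxx A))[X XF <-].
    by move: XF; rewrite !inE => /andP[_ /negPf ->].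
  by move: XF; rewrite !inE => /andP[/negPf -> _].
rewrite -[X in _ + X](@card_in_imset _ _ (fun A => x |: A)); last first.
  move=> A B /setIP[AS _] /setIP[BS _] e.
  have xA := xN A (subsetP (subsetUl _ _) _ AS).
  have xB := xN B (subsetP (subsetUl _ _) _ BS).
  by rewrite -(setU1K xA) e setU1K.
rewrite -cardsUI [X in _ + X]eq_card0 ?addn0; last first.
  move=> A; rewrite inE; apply/negP => /andP[/xN xA /imsetP[B _ eA]].
  by move: xA; rewrite eA setU11.
apply: subset_leq_card; apply/subsetP => A /setUP[AS|].
  have xA := xN A AS; rewrite inE; apply/shattersP => B BA.
  move: AS; rewrite !inE => /orP[] /shattersP/(_ B BA)[X].
    by rewrite inE => /andP[XF _] e; exists X.
  rewrite inE => /andP[xX XF] e; exists (x |: X) => //.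
  rewrite -e; apply/setP => y; rewrite !inE.
  by case: eqVneq => //= ->; rewrite (negPf xA) andbF.
case/imsetP=> A' /setIP[A0 A1] ->; rewrite inE; apply/shattersP => B BA.
have xA : x \notin A' by apply: xN; rewrite inE A0.
have BxA : B :\ x \subset A' by rewrite subDset.
case: (boolP (x \in B)) => xB.
  move: A1; rewrite inE => /shattersP/(_ _ BxA)[X].
  rewrite inE => /andP[_ XF] e; exists (x |: X) => //.
  by rewrite -setUIr e setD1K.
move: A0; rewrite inE => /shattersP/(_ _ BxA)[X].
rewrite inE => /andP[XF xX] e; exists X => //.
rewrite setIUr e; apply/setP => y; rewrite !inE.
case: eqVneq => [->|] //=; first by rewrite (negPf xX) (negPf xB).
by rewrite andbF.
Qed.

(** A set of at most [C] elements is the range of a partial map from ['I_C]. *)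
Lemma card_small_sets (d C : nat) :
  #|[set A : {set 'I_d} | #|A| <= C]| <= d.+1 ^ C.
Proof.
have -> : d.+1 ^ C = #|{ffun 'I_C -> option 'I_d}|.
  by rewrite card_ffun card_option !card_ord.
pose im (f : {ffun 'I_C -> option 'I_d}) := [set x | [exists i, f i == Some x]].
apply: (@leq_trans #|im @: [set: {ffun 'I_C -> option 'I_d}]|); last first.
  by rewrite -cardsT leq_imset_card.
apply: subset_leq_card; apply/subsetP => A; rewrite inE => AC.
apply/imsetP; exists [ffun i : 'I_C => onth (enum A) i] => //.
apply/setP => x; rewrite !inE; apply/idP/existsP => [xA|[i]].
  have lt : index x (enum A) < #|A| by rewrite cardE index_mem mem_enum.
  exists (Ordinal (leq_trans lt AC)); rewrite ffunE /=; apply/eqP.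
  by rewrite onthE (nth_map x) ?nth_index ?mem_enum // -cardE.
by rewrite ffunE -mem_enum => /eqP e; apply/onthP; exists i.
Qed.

Lemma sauer_shelah (d C : nat) (F : {set {set 'I_d}}) :
  (forall A, shatters F A -> #|A| <= C) -> #|F| <= d.+1 ^ C.
Proof.
move=> FC; apply: leq_trans (card_small_sets d C).
apply: leq_trans (@card_le_shatters _ [set: 'I_d] F _) _.
  by move=> X _; apply: subsetT.
by apply: subset_leq_card; apply/subsetP => A; rewrite !inE => /FC.
Qed.

(** For [a > 0], Bernoulli's inequality gives [2 * a ^ a <= a.+1 ^ a]. With [d = a * 2 ^ j] the two
    powers then differ by a factor of at least [2 ^ (2 ^ j)], while [d.+1 ^ e] is at most
    [2 ^ ((j + a.+1) * e)]. *)
Lemma exp_dominates_poly (a e : nat) :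
  exists d, d.+1 ^ e * a ^ d < a.+1 ^ d.
Proof.
case: a => [|a]; first by exists 1; rewrite muln0.
set b := a.+1.
have bern n : b ^ n + n * b ^ n.-1 <= b.+1 ^ n.
  elim: n => [|n IHn]; first by rewrite !expn0.
  rewrite (expnS b.+1); apply: leq_trans (leq_mul (leqnn _) IHn).
  rewrite /= expnS; case: n {IHn} => [|n]; first by rewrite !expn0; lia.
  by rewrite /= expnS; nia.
have dbl : 2 * b ^ b <= b.+1 ^ b.
  have bE : b * b ^ b.-1 = b ^ b by rewrite -expnS.
  by have := bern b; rewrite bE addnn -mul2n.
have dblk k : 2 ^ k * b ^ (b * k) <= b.+1 ^ (b * k).
  by case: k => [|k]; rewrite ?muln0 // !expnM -expnMn leq_exp2r.
pose i := 3 * e + b.+1; pose j := i + i.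
exists (b * 2 ^ j).
have lt1 : (j + b.+1) * e < 2 ^ j.
  have h1 : i < 2 ^ i by apply: ltn_expl.
  rewrite expnD; apply: (@leq_ltn_trans (i * (3 * e))); first by rewrite /j /i; nia.
  by apply: leq_ltn_trans (ltn_mul h1 h1); rewrite leq_mul2l /i leq_addr orbT.
apply: leq_trans (dblk (2 ^ j)).
rewrite ltn_pmul2r ?expn_gt0 //.
apply: (@leq_ltn_trans ((2 ^ (j + b.+1)) ^ e)).
  case: e @i @j lt1 => // e i j _; rewrite leq_exp2r //.
  have hb : b < 2 ^ b by apply: ltn_expl.
  have : 0 < 2 ^ j by rewrite expn_gt0.
  by rewrite expnD expnS; nia.
by rewrite -expnM ltn_exp2l.
Qed.

Lemma card_family_leq (aT rT : finType) (F : aT -> pred rT) (k : nat) :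
  (forall x, #|F x| <= k) -> #|family F| <= k ^ #|aT|.
Proof.
move=> Fk; rewrite card_family /image_mem cardT.
by elim: (enum aT) => //= x e IHe; rewrite expnS leq_mul.
Qed.

(** Group the maps [v] by the profile [x |-> N v x]. Bounded shattering leaves at most
    [d.+1 ^ (C * #|X|)] profiles, and each profile forbids some value of [v s] for every [s]. *)
Lemma colour_avoidance_shatters (X : finType) (C : nat) : 0 < #|X| ->
  exists d, forall N : {ffun 'I_d -> X} -> X -> {set 'I_d},
    (forall v s, s \in N v (v s)) -> (forall v s, exists x, s \notin N v x) ->
    exists x, exists2 A, shatters [set N v x | v : {ffun 'I_d -> X}] A
      & C < #|A|.
Proof.
move=> X0; set a := #|X|.-1; have cX : #|X| = a.+1 by rewrite prednK.
have [d ltd] := exp_dominates_poly a (C * #|X|).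
exists d => N N1 N2; apply: contrapT => noA.
have FC x : #|[set N v x | v : {ffun 'I_d -> X}]| <= d.+1 ^ C.
  apply: sauer_shelah => A shA; rewrite leqNgt; apply/negP => CA.
  by apply: noA; exists x, A.
move: ltd; rewrite ltnNge => /negP; apply.
have -> : a.+1 ^ d = #|{ffun 'I_d -> X}| by rewrite card_ffun card_ord -cX.
pose Phi v := [ffun x => N v x].
rewrite -sum1_card (partition_big_imset Phi) /=.
apply: leq_trans (_ : \sum_(y in [set Phi v | v : {ffun 'I_d -> X}]) a ^ d <= _).
  apply: leq_sum => _ /imsetP[v0 _ ->]; rewrite sum1dep_card.
  pose ok s := [pred x | s \in N v0 x].
  apply: leq_trans (_ : #|family ok| <= _).
    apply: subset_leq_card; apply/subsetP => v; rewrite inE /= => /eqP e.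
    apply/familyP => s; rewrite inE.
    by have /ffunP/(_ (v s)) := e; rewrite !ffunE => <-; apply: N1.
  rewrite -[X in a ^ X]card_ord; apply: card_family_leq => s.
  case: (N2 v0 s) => x xN; rewrite /a -(cardsC1 x).
  apply: subset_leq_card; apply/subsetP => y; rewrite !inE.
  by apply: contraTneq => ->.
rewrite sum_nat_const leq_mul2r; apply/orP; right.
rewrite expnM; apply: leq_trans (card_family_leq
  (F := fun x => mem [set N v x | v : {ffun 'I_d -> X}]) _).
  apply: subset_leq_card; apply/subsetP => _ /imsetP[v _ ->].
  by apply/familyP => x; rewrite ffunE; apply: imset_f.
exact: FC.
Qed.

(** * Closed odd walks *)

(* A closed walk of length [n] is an [n]-periodic sequence, so that it can be
   rotated freely. *)
Definition closed_walk (T : Type) (e : rel T) (n : nat) (w : nat -> T) :=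
  (forall i, e (w i) (w i.+1)) /\ (forall i, w (i + n) = w i).

Lemma closed_walk_shift (T : Type) (e : rel T) n w k :
  closed_walk e n w -> closed_walk e n (fun i => w (k + i)).
Proof. by case=> wE wP; split=> i; rewrite ?addnS // addnA. Qed.

(** Modulo [n], adding [n.-1] is a step back, so no index is ever subtracted. *)
Lemma closed_walk_rev (T : Type) (e : rel T) n w : symmetric e -> 0 < n ->
  closed_walk e n w -> closed_walk e n (fun i => w (i * n.-1)).
Proof.
move=> eC n0 [wE wP]; split=> i.
  have -> : w (i * n.-1) = w (i.+1 * n.-1).+1.
    by rewrite -(wP (i * n.-1)) mulSn addnC -addSn prednK.
  by rewrite eC.
have wPk k j : w (j + k * n) = w j.
  by elim: k => [|k IHk]; rewrite ?addn0 // mulSn addnCA addnC wP.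
by rewrite mulnDl [n * _]mulnC wPk.
Qed.

Lemma closed_walk_fold (T : Type) (e : rel T) (w : nat -> T) k : 0 < k ->
  (forall i, i < k -> e (w i) (w i.+1)) -> w k = w 0 ->
  closed_walk e k (fun i => w (i %% k)).
Proof.
move=> k0 wE wk; split=> i; last by rewrite modnDr.
have ltk : i %% k < k by rewrite ltn_mod.
have -> : w (i.+1 %% k) = w (i %% k).+1; last exact: wE.
rewrite -addn1 -modnDml addn1; case: (ltngtP (i %% k).+1 k) => [lt||e1].
- by rewrite modn_small.
- by rewrite ltnNge ltk.
- by rewrite e1 modnn.
Qed.

(** In other terms, the odd girth of the graph induced on [A] exceeds [m]. *)
Definition no_odd_walk (H : sgraph) (A : {set H}) (m : nat) : Prop :=
  forall n (w : nat -> H), odd n -> n <= m -> (forall i, w i \in A) ->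
    ~ closed_walk (@adj H) n w.

(** A repeated vertex splits the walk into two shorter closed walks, one of which is odd. *)
Lemma shortest_odd_walk_inj (H : sgraph) (A : {set H}) (m : nat)
    (w : nat -> H) i k :
  no_odd_walk A m -> odd m.+1 -> (forall i, w i \in A) ->
  closed_walk (@adj H) m.+1 w -> 0 < k <= m -> w i <> w (i + k).
Proof.
move=> noA gO wA [wE wP].
have key j l : odd l -> l <= m -> w j <> w (j + l).
  move=> lO lm e; have l0 : 0 < l by case: (l) lO.
  apply: (noA l (fun i => w (j + i %% l))) => //.
  apply: (closed_walk_fold (w := fun i => w (j + i))) => //; last by rewrite addn0.
  by move=> t _; rewrite addnS.
case/andP=> k0 km; have [kO|kE] := boolP (odd k); first exact: key.
move=> e; apply: (key (i + k) (m.+1 - k)); last 1 first.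
- by rewrite -addnA subnKC 1?leqW // wP.
- by rewrite oddB 1?leqW // gO (negPf kE).
- by rewrite leq_subLR addnC -addn1 leq_add2l.
Qed.

(** Colour by whether an even walk arrives from the root of the component. Two adjacent vertices
    reached evenly close an odd walk; a vertex not so reached has an odd walk, which extends to an
    even one to its neighbour. *)
Lemma no_odd_walk_bipartite (H : sgraph) (A : {set H}) :
  (forall m, no_odd_walk A m) ->
  exists c : H -> bool,
    forall x y, x \in A -> y \in A -> adj x y -> c x != c y.
Proof.
move=> noA; pose e : rel H := fun x y => [&& x \in A, y \in A & adj x y].
have eC : symmetric e by move=> x y; rewrite /e adj_sym andbCA.
have cC : connect_sym e by apply: sym_connect_sym.
have no_closed z p : path e z p -> last z p = z -> odd (size p) -> False.
  move=> zp lz pO; have p0 : 0 < size p by case: (size p) pO.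
  have E i : i < size p -> e (nth z (z :: p) i) (nth z (z :: p) i.+1).
    by move=> lt; move/(pathP z)/(_ _ lt): zp.
  apply: (noA (size p) (size p) (fun i => nth z (z :: p) (i %% size p))) => //.
    by move=> i; have := E (i %% size p); rewrite ltn_mod p0 => /(_ isT)/andP[].
  apply: (closed_walk_fold (w := fun i => nth z (z :: p) i)) => //.
    by move=> i /E /and3P[].
  by rewrite -[LHS]/(nth z (z :: p) (size p)) nth_last.
pose c x := `[< exists p, [/\ path e (fingraph.root e x) p,
                    last (fingraph.root e x) p = x & ~~ odd (size p)] >].
exists c => x y xA yA xy; have exy : e x y by rewrite /e xA yA.
have rxy : fingraph.root e x = fingraph.root e y.
  by apply/eqP; rewrite root_connect // connect1.
apply/negP => /eqP cxy; have [cx|cx] := boolP (c x).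
  have cy : c y by rewrite -cxy.
  move/asboolP: cx => [p [zp lp pE]]; move/asboolP: cy => [q [zq lq qE]].
  rewrite -rxy in zq lq; set z := fingraph.root e x in zp lp zq lq.
  apply: (no_closed z (rcons p y ++ rev (belast z q))).
  - rewrite cat_path rcons_path zp lp exy last_rcons /= -{1}lq rev_path.
    by rewrite (eq_path (e' := e)) // => a b; rewrite eC.
  - rewrite last_cat last_rcons; case: q {zq qE} lq => //= a q lq.
    by rewrite rev_cons last_rcons.
  - by rewrite size_cat size_rcons size_rev size_belast oddD /= (negPf pE) (negPf qE).
move: cx => /asboolP; apply.
have /connectP[q zq lq] : connect e (fingraph.root e x) x by rewrite cC connect_root.
have [qO|qE] := boolP (odd (size q)); last by exists q.
have : c y.
  apply/asboolP; exists (rcons q y); rewrite -rxy rcons_path zq last_rcons.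
  by rewrite -lq exy size_rcons /= negbK.
by rewrite -cxy => /asboolP.
Qed.

(** * The sparse part of the construction *)

(** Maximality of the rank is what makes [hub_climbs] terminate. *)
Lemma exists_max_neighbour (H : sgraph) (K : {set H}) :
  exists sigma : H -> H, forall a b, b \in K -> adj a b ->
    [/\ sigma a \in K, adj a (sigma a)
      & enum_rank b <= enum_rank (sigma a)].
Proof.
pose nb a := [pred b | (b \in K) && adj a b].
exists (fun a => if [pick b in nb a] is Some b0
                 then [arg max_(b > b0 in nb a) (enum_rank b : nat)] else a).
move=> a b bK ab; have bN : b \in nb a by rewrite inE bK.
case: pickP => [b0 b0N|/(_ b)]; last by rewrite bN.
by case: arg_maxnP => // c /andP[cK ac] /(_ b bN).
Qed.

Section Sparse.
Variables (H : sgraph) (K U : {set H}) (u p : H) (sigma : H -> H) (d m : nat).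

(* In order: the vertices of [U] other than [u] that all copies share, the
   copies of [u], and the copies of the vertices of [K - U]. *)
Definition core : finType :=
  ((H + 'I_d) + ({ffun 'I_d -> H} * H))%type.

Definition fixed (c : core) : bool :=
  if c is inl (inl a) then a \in U :\ u else false.

Definition label (c : core) : H :=
  match c with
  | inl (inl a) => a
  | inl (inr _) => u
  | inr va => va.2
  end.

(* The index types of [core] are too large; invalid vertices are isolated in
   the core. *)
Definition valid (c : core) : bool :=
  (label c \in K) &&
  match c with
  | inl (inl a) => a \in U :\ u
  | inl (inr _) => true
  | inr va => va.2 \notin U
  end.

(** Two copies of [u] may count as compatible, since [core_adj] also asks for adjacent labels. *)
Definition compat (c c' : core) : bool :=
  match c, c' with
  | inl (inr s), inr va | inr va, inl (inr s) => va.1 s == va.2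
  | inr va, inr vb => va.1 == vb.1
  | _, _ => true
  end.

Definition core_adj (c c' : core) : bool :=
  [&& valid c, valid c', adj (label c) (label c') & compat c c'].

(* Invalid core vertices and vertices isolated in [K] are treated like the
   arbitrary non-isolated vertex [p]. *)
Definition inner (a : H) : bool :=
  (a \in K) && [exists b, (b \in K) && adj a b].

Definition retract (a : H) : H := if inner a then a else p.

Definition core_proj (c : core) : H :=
  if valid c then retract (label c) else p.

(* The big sets [B_a] ([a : H]), with [B_a] joined to the core vertices over
   [a] and to [B_(sigma a)]; [B_a] lies over [sigma a]. *)
Definition sparse : finType := (core + H * 'I_m)%type.

Definition sparse_adj (x y : sparse) : bool :=
  match x, y with
  | inl c, inl c' => core_adj c c'
  | inl c, inr b | inr b, inl c => core_proj c == retract b.1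
  | inr b, inr b' => (sigma (retract b.1) == retract b'.1)
                     || (sigma (retract b'.1) == retract b.1)
  end.

Definition proj (x : sparse) : H :=
  match x with
  | inl c => core_proj c
  | inr b => sigma (retract b.1)
  end.

Lemma sparse_adj_sym : symmetric sparse_adj.
Proof.
case=> [c|b] [c'|b'] //=; last by rewrite orbC.
rewrite /core_adj adj_sym andbCA; congr [&& _, _, _ & _].
by case: c c' => [[a|s]|va] [[a'|s']|vb] //=; rewrite eq_sym.
Qed.

Hypothesis p_inner : inner p.
Hypothesis sigmaP : forall a b, b \in K -> adj a b ->
  [/\ sigma a \in K, adj a (sigma a) & enum_rank b <= enum_rank (sigma a)].

Lemma retract_inner a : inner (retract a).
Proof. by rewrite /retract; case: ifP. Qed.

Lemma retract_id a : inner a -> retract a = a.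
Proof. by rewrite /retract => ->. Qed.

Lemma core_proj_inner c : inner (core_proj c).
Proof. by rewrite /core_proj; case: ifP => // _; apply: retract_inner. Qed.

Lemma inner_sigma a : inner a -> inner (sigma a) && adj a (sigma a).
Proof.
move=> /andP[aK /existsP[b /andP[bK ab]]].
have [sK sa _] := sigmaP bK ab; rewrite sa andbT /inner sK /=.
by apply/existsP; exists a; rewrite aK adj_sym.
Qed.

Lemma proj_inner x : inner (proj x).
Proof.
case: x => [c|b] /=; first exact: core_proj_inner.
by have /inner_sigma/andP[] := retract_inner b.1.
Qed.

Lemma core_adj_proj c c' : core_adj c c' -> core_proj c = label c.
Proof.
case/and4P=> cV c'V cc' _; rewrite /core_proj cV retract_id // /inner.
case/andP: cV => -> _; apply/existsP; exists (label c').
by case/andP: c'V => ->.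
Qed.

Lemma sparse_adj_proj x y : sparse_adj x y -> adj (proj x) (proj y).
Proof.
have sa b : adj (retract b) (sigma (retract b)).
  by have /inner_sigma/andP[] := retract_inner b.
case: x y => [c|b] [c'|b'] /=.
- move=> cc'; rewrite (core_adj_proj cc'); move: (cc').
  rewrite -[core_adj _ _]/(sparse_adj (inl c) (inl c')) sparse_adj_sym /=.
  by move/core_adj_proj ->; case/and4P: cc'.
- by move/eqP ->.
- by move/eqP ->; rewrite adj_sym.
- by case/orP => /eqP e; [rewrite {1}e | rewrite -e adj_sym e]; rewrite ?[X in adj _ X]e.
Qed.

Lemma sparse_adj_irr : irreflexive sparse_adj.
Proof. by move=> x; apply/negP => /sparse_adj_proj; rewrite adj_irr. Qed.

Variable g : nat.
Hypothesis noK : no_odd_walk K g.-1.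
Hypothesis noKU : no_odd_walk (K :\: U) g.
Hypothesis g_odd : odd g.

Section Walk.
Variable w : nat -> sparse.
Hypothesis wW : closed_walk sparse_adj g w.

Lemma proj_walk : closed_walk (@adj H) g (proj \o w).
Proof.
case: wW => wE wP; split=> i /=; first exact: sparse_adj_proj.
by rewrite wP.
Qed.

(** The projection is a closed walk in [K] of the shortest possible odd length. *)
Lemma proj_walk_inj i k : 0 < k < g -> proj (w i) <> proj (w (i + k)).
Proof.
have g0 : 0 < g by case: (g) g_odd.
move=> /andP[k0 kg].
apply: (shortest_odd_walk_inj (w := proj \o w) noK); rewrite ?prednK //.
- by move=> j; case/andP: (proj_inner (w j)).
- exact: proj_walk.
- by rewrite k0 /= -ltnS prednK.
Qed.

Lemma g_ge3 : 2 < g.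
Proof.
case: (g) g_odd proj_walk => [|[|[|n]]] // _ [/(_ 0) /= aE /(_ 0) /= aP].
by move: aE; rewrite -aP adj_irr.
Qed.

Definition hub (x : sparse) (y : H) : bool :=
  if x is inr b then retract b.1 == y else false.

Lemma hubP x y : reflect (exists2 b, x = inr b & retract b.1 = y) (hub x y).
Proof.
case: x => [c|b] /=; first by constructor=> -[].
by apply: (iffP eqP) => [<-|[_ [<-]]] //; exists b.
Qed.

(* A non-backtracking image forces a walk that moves up along [sigma] to keep
   doing so, and two such steps increase the rank since [sigma] picks the
   neighbour of largest rank. *)
Lemma hub_climbs y : hub (w 0) y -> ~ hub (w 1) (sigma y).
Proof.
case: wW => wE wP h0 h1.
have hstep i y' : hub (w i) y' -> hub (w i.+1) (sigma y') ->
    hub (w i.+2) (sigma (sigma y')).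
  move=> /hubP[b wb by'] /hubP[b' wb' b'y].
  (* Any other continuation gives [w i.+2] the projection of [w i], namely [sigma y']. *)
  have := @proj_walk_inj i 2 g_ge3; rewrite addn2 wb /= by' => ne.
  have := wE i.+1; rewrite wb' /=; case wi2 : (w i.+2) => [c|b2] /= e.
    by case: ne; rewrite wi2 /= (eqP e) b'y.
  case/orP: e => /eqP e; first by rewrite -e b'y.
  by case: ne; rewrite wi2 /= e b'y.
have hall i : hub (w i) (iter i sigma y) && hub (w i.+1) (iter i.+1 sigma y).
  elim: i => [|i /andP[IH0 IH1]]; first by rewrite h0.
  by rewrite IH1 /= hstep.
have inn i : inner (iter i sigma y).
  case/andP: (hall i) => /hubP[b _ <-] _; exact: retract_inner.
have up i : enum_rank (iter i sigma y) < enum_rank (iter i.+2 sigma y).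
  have /andP[_ asa] := inner_sigma (inn i); have /andP[aK _] := inn i.
  rewrite adj_sym in asa; have [_ _ le] := sigmaP aK asa.
  rewrite ltn_neqAle le andbT; apply/eqP => /ord_inj/enum_rank_inj e.
  have := @proj_walk_inj i 2; rewrite g_ge3 addn2 => /(_ isT).
  have /andP[/hubP[b1 -> b1E] _] := hall i.
  have /andP[_ /hubP[b2 -> b2E]] := hall i.+1.
  by rewrite /= b1E b2E /=; move: e => /= <-.
have upk k : k <= enum_rank (iter k.*2 sigma y).
  by elim: k => // k IHk; apply: leq_ltn_trans IHk _; rewrite doubleS up.
by have := leq_ltn_trans (upk #|H|) (ltn_ord _); rewrite ltnn.
Qed.
End Walk.

(** By [hub_climbs], for the walk and its reverse, both walk neighbours of a vertex in a big set
    project to the retracted index of that set, against injectivity. *)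
Lemma shortest_walk_core (w : nat -> sparse) i :
  closed_walk sparse_adj g w -> exists c, w i = inl c.
Proof.
wlog -> : w i / i = 0.
  move=> wl wW; have := wl _ 0 erefl (closed_walk_shift i wW).
  by rewrite addn0.
case w0 : (w 0) => [c|b] wW; first by exists c.
have g0 : 0 < g by case: (g) g_odd.
have rW := closed_walk_rev sparse_adj_sym g0 wW.
have up := hub_climbs wW (y := retract b.1).
have dn := hub_climbs rW (y := retract b.1).
rewrite mul0n mul1n w0 /= eqxx in up dn.
move: up dn => /(_ isT) up /(_ isT) dn; exfalso.
have side x : sparse_adj (inr b) x -> ~ hub x (sigma (retract b.1)) ->
    proj x = retract b.1.
  case: x => [c|b'] /=; first by move/eqP.
  by case/orP => /eqP e // []; rewrite e.
case: (wW) => wE wP.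
have e1 : proj (w 1) = retract b.1 by apply: side up; rewrite -w0.
have eg : proj (w g.-1) = retract b.1.
  apply: side dn; rewrite -w0 sparse_adj_sym.
  by have := wE g.-1; rewrite prednK // -[g]add0n wP.
have g3 := g_ge3 wW.
have := @proj_walk_inj w wW 1 (g.-2); rewrite e1 add1n prednK; last by lia.
by rewrite eg => /(_ _ erefl); apply; lia.
Qed.

Lemma no_odd_sparse_walk (w : nat -> sparse) :
  closed_walk sparse_adj g w ->
  ~ (forall i, if w i is inl c then ~~ fixed c else true).
Proof.
move=> wW unfixed; have [c wc] : {c : nat -> core | forall i, w i = inl (c i)}.
  have h i := cid (shortest_walk_core i wW).
  by exists (fun i => sval (h i)) => i; case: (h i).
case: (wW) => wE wP.
have cE i : core_adj (c i) (c i.+1) by have := wE i; rewrite !wc.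
have cL i : proj (w i) = label (c i) by rewrite wc /= (core_adj_proj (cE i)).
have vI i : valid (c i) by case/and4P: (cE i).
have lK i : label (c i) \in K by case/andP: (vI i).
have g3 := g_ge3 wW.
have cN i : (exists s, c i = inl (inr s)) \/ (exists va, c i = inr va).
  have := unfixed i; rewrite wc; have := vI i; rewrite /valid.
  case: (c i) => [[a|s]|va] /=; first by move=> /andP[_ ->].
    by left; exists s.
  by right; exists va.
have [[i [s cs]]|noS] := pselect (exists i s, c i = inl (inr s)); last first.
  have cV i : exists va, c i = inr va.
    by case: (cN i) => // -[s e]; case: noS; exists i, s.
  apply: (noKU (n := g) (w := fun i => label (c i))) => //.
    move=> i; have [va e] := cV i; have := vI i.
    by rewrite /valid e /= inE andbC.
  by case: (proj_walk wW) => pE pP; split=> i; rewrite -!cL; [apply: pE | apply: pP].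
wlog i0 : w c wW unfixed wc wE wP cE cL vI lK cN i cs / i = 0.
  move=> wl; apply: (wl (fun j => w (i + j)) (fun j => c (i + j))
    _ _ _ _ _ _ _ _ _ _ 0) => //.
  - exact: closed_walk_shift.
  - by move=> j; rewrite addnS.
  - by move=> j; rewrite addnA.
  - by move=> j; rewrite addnS.
  - by rewrite addn0.
subst i.
(* A second copy of [u] within one period would repeat the projection [u]. *)
have cV j : 0 < j < g -> exists va, c j = inr va.
  move=> jg; case: (cN j) => // -[s' e].
  by case: (proj_walk_inj wW (i := 0) jg); rewrite add0n !cL cs e.
have [va c1] := cV 1 (ltnW g3).
have vc j : 0 < j < g -> exists a, c j = inr (va.1, a).
  elim: j => // -[_ _|j IHj /andP[_ jg]];
    first by exists va.2; rewrite c1 -surjective_pairing.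
  have [|a ca] := IHj; first by lia.
  have [|vb cb] := cV j.+2; first by rewrite jg.
  exists vb.2; rewrite cb; have /and4P[_ _ _] := cE j.+1.
  by rewrite ca cb /= => /eqP ->; rewrite -surjective_pairing.
have g1 : 0 < g.-1 < g by lia.
have [a ca] := vc g.-1 g1.
(* The first and the last step of the walk both use the only possible neighbour of [s] in the copy
   [va.1]. *)
have e1 : va.1 s = va.2.
  by have /and4P[_ _ _] := cE 0; rewrite cs c1 /= => /eqP.
have e2 : va.1 s = a.
  have cg : c g = inl (inr s) by have := wP 0; rewrite !wc cs add0n => -[].
  have /and4P[_ _ _] := cE g.-1; rewrite prednK ?cg ?ca /=; last by lia.
  by move/eqP.
have := @proj_walk_inj w wW 1 (g.-2); rewrite add1n prednK; last by lia.
by rewrite !cL c1 ca /= -e1 -e2 => /(_ _ erefl); apply; lia.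
Qed.
End Sparse.

(** * The join and its maximal extension *)

(** The colour classes are the deleted independent sets; [None] marks the vertices that remain. *)
Definition partial_colouring (H : sgraph) rho (c : {ffun H -> option 'I_rho}) :=
  forall x y, adj x y -> c x = c y -> c x = None.

Definition uncoloured (H : sgraph) rho (c : {ffun H -> option 'I_rho}) :=
  [set x | c x == None].

Lemma colorable_finType (G : sgraph) (X : finType) (f : G -> X) :
  (forall x y, adj x y -> f x != f y) -> colorable G #|X|.
Proof.
move=> fP; apply/existsP; exists [ffun x => enum_rank (f x)].
apply/forallP => x; apply/forallP => y; apply/implyP => /fP.
by rewrite !ffunE; apply: contraNneq => /enum_rank_inj ->.
Qed.

(** Otherwise the remaining graph is bipartite, and two more colours complete a proper colouring. *)
Lemma partial_colouring_odd_walk (H : sgraph) rho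
    (c : {ffun H -> option 'I_rho}) :
  ~~ colorable H rho.+2 -> partial_colouring c ->
  exists m, ~ no_odd_walk (uncoloured c) m.
Proof.
move=> /negP nH cP; apply: contrapT => no; apply: nH.
have noc m : no_odd_walk (uncoloured c) m.
  by apply: contrapT => h; apply: no; exists m.
have [b bP] := no_odd_walk_bipartite noc.
have -> : rho.+2 = #|{: 'I_rho + bool}| by rewrite card_sum card_ord card_bool addn2.
apply: (colorable_finType
  (f := fun x => if c x is Some i then inl i else inr (b x))) => x y xy.
case cx : (c x) => [i|]; case cy : (c y) => [j|] //.
  by apply/eqP => -[e]; have := cP x y xy; rewrite cx cy e => /(_ erefl).
have : b x != b y by apply: bP; rewrite // inE ?cx ?cy.
by apply: contra => /eqP[->].
Qed.

Lemma no_odd_walkW (H : sgraph) (A : {set H}) m n :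
  m <= n -> no_odd_walk A n -> no_odd_walk A m.
Proof. by move=> mn noA k w kO km; apply: noA => //; apply: leq_trans mn. Qed.

(* [g] is the largest odd girth that deleting [rho] independent sets from [H]
   can leave, and [U] is a smallest vertex set whose further deletion pushes
   the odd girth beyond [g]. *)
Lemma extremal_deletion (H : sgraph) rho : ~~ colorable H rho.+2 ->
  exists g (c : {ffun H -> option 'I_rho}) (U : {set H}) (u : H),
  [/\ odd g, partial_colouring c, no_odd_walk (uncoloured c) g.-1 &
   [/\ no_odd_walk (uncoloured c :\: U) g, u \in U, u \in uncoloured c &
    forall (c' : {ffun H -> option 'I_rho}) (U' : {set H}),
      partial_colouring c' -> no_odd_walk (uncoloured c') g.-1 ->
      no_odd_walk (uncoloured c' :\: U') g -> #|U| <= #|U'|]].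
Proof.
move=> nH.
pose P m := `[< exists2 c : {ffun H -> option 'I_rho},
                  partial_colouring c & no_odd_walk (uncoloured c) m >].
have P0 : exists m, P m.
  exists 0; apply/asboolP; exists [ffun _ => None].
    by move=> x y _ _; rewrite ffunE.
  by move=> n w; case: n.
have [f fP] : {f : {ffun H -> option 'I_rho} -> nat | forall c,
    partial_colouring c -> ~ no_odd_walk (uncoloured c) (f c)}.
  have h (c : {ffun H -> option 'I_rho}) :
      {m | partial_colouring c -> ~ no_odd_walk (uncoloured c) m}.
    apply: cid; have [cP|] := pselect (partial_colouring c); last by exists 0.
    by have [m] := partial_colouring_odd_walk nH cP; exists m.
  by exists (fun c => sval (h c)) => c; case: (h c).
have Pb m : P m -> m <= \max_c f c.
  move=> /asboolP[c cP noc]; rewrite leqNgt; apply/negP => lt.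
  apply: (fP c cP); apply: no_odd_walkW noc.
  by apply: leq_trans (ltnW lt); apply: leq_bigmax.
case: (ex_maxnP P0 Pb) => m0 /asboolP[c1 c1P noc1] m0max {P0 Pb f fP}.
have nP (c : {ffun H -> option 'I_rho}) :
    partial_colouring c -> ~ no_odd_walk (uncoloured c) m0.+1.
  move=> cP noc; have := m0max m0.+1; rewrite ltnn => h.
  by apply/notF/h/asboolP; exists c.
(* If [m0.+1] were even, excluding odd lengths up to [m0] would exclude those up to [m0.+1]. *)
have gO : odd m0.+1.
  have [//|gE] := boolP (odd m0.+1); case: (nP c1 c1P) => n w nO nm wA.
  apply: (noc1 n w) => //; rewrite -ltnS ltn_neqAle nm andbT.
  by apply: contraNneq gE => <-.
pose Q k := `[< exists (c : {ffun H -> option 'I_rho}) (U : {set H}),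
   [/\ partial_colouring c, no_odd_walk (uncoloured c) m0,
       no_odd_walk (uncoloured c :\: U) m0.+1 & #|U| = k] >].
have Q0 : exists k, Q k.
  exists #|uncoloured c1|; apply/asboolP; exists c1, (uncoloured c1); split=> //.
  by move=> n w _ _ /(_ 0); rewrite setDv inE.
case: (ex_minnP Q0) => k /asboolP[c [U [cP noc nocU <-]]] Umin {Q0 k}.
have min (c' : {ffun H -> option 'I_rho}) (U' : {set H}) :
    partial_colouring c' -> no_odd_walk (uncoloured c') m0 ->
    no_odd_walk (uncoloured c' :\: U') m0.+1 -> #|U| <= #|U'|.
  by move=> *; apply: Umin; apply/asboolP; exists c', U'.
(* If [U] missed the uncoloured vertices, its deletion would change nothing, against the maximality
   of [m0]. *)
have [/setP UK0|[u]] := set_0Vmem (U :&: uncoloured c).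
  case: (nP c cP); suff <- : uncoloured c :\: U = uncoloured c by [].
  by apply/setDidPl; rewrite disjoint_sym -setI_eq0; apply/eqP/setP.
by rewrite inE => /andP[uU uK]; exists m0.+1, c, U, u.
Qed.

(** Edges are added one by one while no copy of [H] appears. The result is a relation on the same
    vertices, so that the vertices of the construction keep their names. *)
Lemma maximal_extension (H G : sgraph) : subgraph_free H G ->
  exists (e : rel G) (eS : symmetric e) (eI : irreflexive e),
    subrel (@adj G) e /\ maximal_free H (SGraph eS eI).
Proof.
case: G => V a aS aI /=.
have [n] := ubnP #|[set xy : V * V | ~~ a xy.1 xy.2]|.
elim: n => // n IHn in a aS aI *; rewrite ltnS => len Gfree.
have [mx|nmx] := pselect (maximal_free H (SGraph aS aI)).
  by exists a, aS, aI; split.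
have [x [y [xy nxy xyfree]]] : exists x y : V,
    [/\ x != y, ~~ a x y & ~ contains (@add_edge (SGraph aS aI) x y) H].
  apply: contrapT => h; apply: nmx; split=> // x y xy nxy.
  by apply: contrapT => h'; apply: h; exists x, y.
have [|e [eS [eI [ae me]]]] := IHn _ (@add_edge_sym (SGraph aS aI) x y)
    (@add_edge_irr (SGraph aS aI) x y) _ xyfree; last first.
  by exists e, eS, eI; split=> // s t st; apply: ae; rewrite /add_edge_rel /= st.
apply: leq_trans len; apply: proper_card; apply/properP; split.
  apply/subsetP => st; rewrite !inE /add_edge_rel /=.
  by apply: contra => ->.
exists (x, y); rewrite !inE //= negbK.
by apply/orP; right; rewrite xy eqxx.
Qed.

(** The bound on [#|G|] covers the initial value of the minimum. *)
Lemma min_degree_geq (G : sgraph) k : k <= #|G| ->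
  (forall v : G, k <= #|neigh v|) -> k <= min_degree G.
Proof.
move=> kG kN; apply: (big_ind (fun n => k <= n)) => // a b ka kb.
by rewrite leq_min ka.
Qed.

Lemma card_neigh_geq (G : sgraph) (v : G) (T : finType) (f : T -> G) :
  injective f -> (forall t, adj v (f t)) -> #|T| <= #|neigh v|.
Proof.
move=> fI fA; rewrite -(card_imset T fI); apply: subset_leq_card.
by apply/subsetP => _ /imsetP[t _ ->]; rewrite inE.
Qed.

Section Host.
Variables (H : sgraph) (rho g d m M : nat) (c : {ffun H -> option 'I_rho}).
Variables (U : {set H}) (u p : H) (sigma : H -> H).
Let K := uncoloured c.

Hypothesis p_inner : inner K p.
Hypothesis sigmaP : forall a b, b \in K -> adj a b ->
  [/\ sigma a \in K, adj a (sigma a) & enum_rank b <= enum_rank (sigma a)].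

Definition host : finType := (sparse H d m + 'I_rho * 'I_M)%type.

Definition host_adj (x y : host) : bool :=
  match x, y with
  | inl x, inl y => sparse_adj K U u p sigma x y
  | inr i, inr j => i.1 != j.1
  | _, _ => true
  end.

Lemma host_adj_sym : symmetric host_adj.
Proof.
by case=> [x|i] [y|j] //=; [apply: sparse_adj_sym | rewrite eq_sym].
Qed.

Lemma host_adj_irr : irreflexive host_adj.
Proof. by case=> [x|i] /=; [apply: sparse_adj_irr | rewrite eqxx]. Qed.

Definition host_graph : sgraph := SGraph host_adj_sym host_adj_irr.

Lemma card_host : #|host| = #|core H d| + #|H| * m + rho * M.
Proof. by rewrite !(card_sum, card_prod, card_ord). Qed.

(** A sparse vertex sees one big set and all parts; a vertex of a part sees all big sets and the
    other parts. The two counts agree because [#|H| * m = m + M]. *)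
Lemma card_neigh_host (x : host) : M = #|H|.-1 * m ->
  m + rho * M <= #|neigh (x : host_graph)|.
Proof.
move=> ME; have H0 : 0 < #|H| by apply/card_gt0P; exists u.
case: x => [x|[i k]].
  have -> : m + rho * M = #|{: 'I_m + 'I_rho * 'I_M}|.
    by rewrite card_sum card_prod !card_ord.
  have [h hx] : exists h, forall j : 'I_m, sparse_adj K U u p sigma x (inr (h, j)).
    case: x => [a|b] /=.
      exists (core_proj K U u p a) => j; rewrite retract_id //.
      exact: core_proj_inner.
    exists (sigma (retract K p b.1)) => j; rewrite [X in _ == X]retract_id ?eqxx //.
    by have /andP[] := inner_sigma sigmaP (retract_inner p_inner b.1).
  apply: (card_neigh_geq (f := fun t : 'I_m + 'I_rho * 'I_M =>
    match t with inl j => inl (inr (h, j)) | inr ik => inr ik end : host_graph)).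
    by case=> [j|ik] [j'|ik'] //= [->].
  by case=> [j|ik] //=; apply: hx.
have -> : m + rho * M = #|{: H * 'I_m + 'I_rho.-1 * 'I_M}|.
  rewrite card_sum !card_prod !card_ord ME.
  have : 0 < rho by case: (rho) i => [[]|].
  by case: (rho) #|H| H0 => // r [//|h] _ _ /=; rewrite !mulSn addnA.
apply: (card_neigh_geq (f := fun t : H * 'I_m + 'I_rho.-1 * 'I_M =>
  match t with inl aj => inl (inr aj) | inr jk => inr (lift i jk.1, jk.2) end
    : host_graph)).
  case=> [aj|[j l]] [aj'|[j' l']] //= e; first by case: e => ->.
  have [e1 e2] : lift i j = lift i j' /\ l = l' by split; congruence.
  by rewrite (lift_inj e1) e2.
by case=> [aj|jk] //=; apply: neq_lift.
Qed.

Hypothesis g_odd : odd g.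
Hypothesis noK : no_odd_walk K g.-1.
Hypothesis noKU : no_odd_walk (K :\: U) g.
Hypothesis uU : u \in U.
Hypothesis Umin : forall (c' : {ffun H -> option 'I_rho}) (U' : {set H}),
  partial_colouring c' -> no_odd_walk (uncoloured c') g.-1 ->
  no_odd_walk (uncoloured c' :\: U') g -> #|U| <= #|U'|.

(** In a copy of [H], the parts define a partial colouring [c'], and the vertices placed on fixed
    core vertices form a deletion set [U'] smaller than [U]. *)
Lemma host_free : subgraph_free H host_graph.
Proof.
case=> f f_inj fA.
pose c' : {ffun H -> option 'I_rho} :=
  [ffun x => if f x is inr ik then Some ik.1 else None].
pose U' := [set x | [exists a in U :\ u, f x == inl (inl (inl (inl a))) :> host]].
have c'P : partial_colouring c'.
  move=> x y xy; rewrite !ffunE; have := fA x y xy.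
  by case: (f x) (f y) => [x'|i] [y'|j] //= ij [e]; rewrite e eqxx in ij.
have lift w n : (forall i, w i \in uncoloured c') -> closed_walk (@adj H) n w ->
    exists2 w', closed_walk (@sparse_adj H K U u p sigma d m) n w'
              & forall i, f (w i) = inl (w' i).
  move=> wA [wE wP].
  have h i : {x | f (w i) = inl x}.
    apply: cid; have := wA i; rewrite inE ffunE.
    by case: (f (w i)) => // x _; exists x.
  exists (fun i => sval (h i)) => [|i]; last by case: (h i).
  split=> i; case: (h i) (h i.+1) => x xE [y yE] /=.
    by have := fA _ _ (wE i); rewrite xE yE.
  by case: (h (i + n)) => z /=; rewrite wP xE => -[].
have noc' : no_odd_walk (uncoloured c') g.-1.
  move=> n w nO ng wA /(lift _ _ wA)[w' [wE wP] _].
  apply: (noK (n := n) (w := fun i => proj K U u p sigma (w' i))) => //.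
    by move=> i; have /andP[] := proj_inner U u p_inner sigmaP (w' i).
  split=> i; last by rewrite wP.
  exact: (sparse_adj_proj p_inner sigmaP (wE i)).
have g0 : 0 < g by case: (g) g_odd.
have noc'U : no_odd_walk (uncoloured c' :\: U') g.
  move=> n w nO ng wA wW.
  have wA' i : w i \in uncoloured c' by have /setDP[] := wA i.
  (* Only length [g] needs [U']; shorter walks are excluded by [noc']. *)
  move: ng; rewrite leq_eqVlt => /orP[/eqP ng|ng]; last first.
    by apply: (noc' n w) => //; rewrite -ltnS prednK.
  subst n; have [w' w'W fw'] := lift _ _ wA' wW.
  apply: (no_odd_sparse_walk p_inner sigmaP noK noKU g_odd w'W) => i.
  case wi : (w' i) => [[[a|s]|va]|b] //=; apply/negP => aU.
  have /setDP[_] := wA i; rewrite inE => /negP; apply.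
  by apply/exists_inP; exists a => //; rewrite fw' wi.
have := Umin c'P noc' noc'U; rewrite leqNgt => /negP; apply.
rewrite [X in _ < X](cardsD1 u) uU add1n ltnS.
rewrite -(card_imset U' f_inj).
rewrite -(card_imset (U :\ u) (f := fun a => inl (inl (inl (inl a))) : host)); last first.
  by move=> a b [].
apply: subset_leq_card; apply/subsetP => _ /imsetP[x xU ->].
by move: xU; rewrite inE => /exists_inP[a aU /eqP ->]; apply: imset_f.
Qed.

Definition host_s (s : 'I_d) : host := inl (inl (inl (inr s))).
Definition host_v (v : {ffun 'I_d -> H}) (x : H) : host := inl (inl (inr (v, x))).

Definition free_nbr (x : H) : bool := [&& adj u x, x \in K & x \notin U].

Hypothesis cP : partial_colouring c.
Hypothesis uK : u \in K.
Hypothesis HM : #|H| <= M.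

(** The fixed vertices, the copy [s] of [u] and the copy [v] of [K - U] then carry [K], and the
    colour classes fit into the parts. *)
Lemma host_contains (e : rel host) (eS : symmetric e) (eI : irreflexive e) v s :
  subrel host_adj e ->
  (forall x, free_nbr x -> e (host_s s) (host_v v x)) ->
  contains (SGraph eS eI) H.
Proof.
move=> he ev.
pose k (a : H) : core H d := if a == u then inl (inr s) else
  if a \in U then inl (inl a) else inr (v, a).
pose f (a : H) : host := if c a is Some i
  then inr (i, widen_ord HM (enum_rank a)) else inl (inl (k a)).
have k_lab a : label u (k a) = a.
  by rewrite /k; case: eqVneq => [->|_] //; case: ifP.
have k_val a : a \in K -> valid K U u (k a).
  rewrite /valid k_lab => ->; rewrite /k; case: eqVneq => //= au.
  by case: ifP => /= [aU|->] //; rewrite !inE au aU.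
exists f => [a b|a b ab].
  rewrite /f; case: (c a) (c b) => [i|] [j|] //.
    by move=> -[_ /ord_inj/enum_rank_inj].
  by move=> [kab]; rewrite -(k_lab a) kab k_lab.
rewrite /= /f; case ca : (c a) => [i|]; case cb : (c b) => [j|].
- apply: he => /=; apply/eqP => ij.
  by have := cP ab; rewrite ca cb ij => /(_ erefl).
- exact: he.
- exact: he.
have aK : a \in K by rewrite inE ca.
have bK : b \in K by rewrite inE cb.
(* By symmetry, an edge between [u] and [K - U] is taken with [u] as its first end. *)
wlog bu : a b ab ca cb aK bK / b == u -> a \in U.
  move=> wl; have [bu|] := eqVneq b u; last by move/negPf=> bu; apply: wl; rewrite ?bu.
  rewrite eS; apply: wl => //; first by rewrite adj_sym.
  by rewrite bu.
have [au|au] := eqVneq a u.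
  subst a; have [bU|bU] := boolP (b \in U); last first.
    rewrite /k eqxx (negPf bU);
    case: eqVneq => [e1|_]; first by rewrite e1 adj_irr in ab.
    by apply: (ev b); rewrite /free_nbr ab bK.
  apply: he; rewrite /= /core_adj !k_val // !k_lab ab /= /k eqxx bU.
  by case: eqVneq.
apply: he; rewrite /= /core_adj !k_val // !k_lab ab /= /k (negPf au).
have [/eqP/bu ->|_] := eqVneq b u; first by [].
by case: ifP; case: ifP => //=.
Qed.

Lemma host_VC (C : nat) (e : rel host) (eS : symmetric e) (eI : irreflexive e) :
  (forall N : {ffun 'I_d -> H} -> H -> {set 'I_d},
    (forall v s, s \in N v (v s)) -> (forall v s, exists x, s \notin N v x) ->
    exists x, exists2 A, shatters [set N v x | v : {ffun 'I_d -> H}] A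
      & C < #|A|) ->
  subrel host_adj e -> subgraph_free H (SGraph eS eI) -> C < VC (SGraph eS eI).
Proof.
move=> ramsey he Gfree.
(* Outside [free_nbr] the full set keeps [s \in N v (v s)] true and shatters only the empty set. *)
pose N v x := if free_nbr x then [set s | e (host_s s) (host_v v x)] else [set: 'I_d].
have [||x [A shA CA]] := ramsey N.
- move=> v s; rewrite /N; case: ifP => [/and3P[ux xK xU]|]; rewrite inE //.
  by apply: he; rewrite /= /core_adj /valid /= uK xK xU ux /=.
- move=> v s; apply: contrapT => h; apply: Gfree.
  apply: (@host_contains _ _ _ v s he) => x xN; apply: contrapT => ne; apply: h.
  by exists x; rewrite /N xN inE; apply/negP.
have [xN|xN] := boolP (free_nbr x); last first.
  have /shattersP/(_ set0 (sub0set A))[X] := shA.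
  case/imsetP=> v _ ->; rewrite /N (negPf xN) setTI => A0.
  by rewrite A0 cards0 in CA.
have sI : injective host_s by move=> s t [].
apply: leq_trans CA _; rewrite -(card_imset A sI).
apply: (leq_bigmax_cond (F := fun S : {set SGraph eS eI} => #|S|)).
apply/eqP/setP => B; rewrite powersetE; apply/imsetP/idP.
  by case=> y _ ->; apply: subsetIr.
move=> BA; have sB : host_s @^-1: B \subset A.
  apply/subsetP => s; rewrite inE => /(subsetP BA)/imsetP[t tA /sI ->] //.
have /shattersP/(_ _ sB)[X /imsetP[v _ ->]] := shA.
rewrite /N xN => /setP eB; exists (host_v v x) => //.
apply/setP => y; apply/idP/idP => [yB|].
  have /imsetP[s sA ey] := subsetP BA _ yB.
  have := eB s; rewrite !inE sA -ey yB andbT eS => ve.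
  by rewrite /= ve ey imset_f.
rewrite !inE => /andP[ye /imsetP[s sA ey]].
have := eB s; rewrite !inE sA -ey eS andbT => <-.
exact: ye.
Qed.
End Host.

(** * Large VC-dimension and the bound on the threshold *)

Lemma exists_inner (H : sgraph) rho (c : {ffun H -> option 'I_rho}) :
  ~~ colorable H rho.+2 -> partial_colouring c ->
  exists p, inner (uncoloured c) p.
Proof.
move=> nH cP; have [m nw] := partial_colouring_odd_walk nH cP.
apply: contrapT => noP; apply: nw => n w _ _ wA [wE _]; apply: noP.
exists (w 0); rewrite /inner wA; apply/existsP; exists (w 1).
by rewrite wA wE.
Qed.

(** As [k] does not depend on [m], the guaranteed relative minimum degree tends to [(rho *
    #|H|.-1).+1 / (#|H| + rho * #|H|.-1)]. *)
Lemma maximal_free_large_VC (H : sgraph) rho C : ~~ colorable H rho.+2 ->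
  exists k, forall m, 1 < m -> exists G : sgraph,
  [/\ maximal_free H G, #|G| = k + m * (#|H| + rho * #|H|.-1),
      m * (rho * #|H|.-1).+1 <= min_degree G & C < VC G].
Proof.
move=> nH.
have [g [c [U [u [gO cP noK [noKU uU uK Umin]]]]]] := extremal_deletion nH.
have H0 : 0 < #|H| by apply/card_gt0P; exists u.
have [d ramsey] := colour_avoidance_shatters C H0.
have [p pI] := exists_inner nH cP.
have [sigma sigmaP] := exists_max_neighbour (uncoloured c).
exists #|core H d| => m m1; pose M := #|H|.-1 * m.
have H1 : 1 < #|H|.
  have /andP[_ /existsP[b /andP[_ pb]]] := pI.
  rewrite (cardD1 p) (cardD1 b) !inE.
  by case: eqVneq => // e; rewrite e adj_irr in pb.
(* This is where [1 < m] enters. *)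
have HM : #|H| <= M by rewrite /M; nia.
have free := @host_free H rho g d m M c U u p sigma pI sigmaP gO noK noKU uU Umin.
have [e [eS [eI [he emax]]]] := maximal_extension free.
have cardG : #|SGraph eS eI| = #|core H d| + m * (#|H| + rho * #|H|.-1).
  by rewrite [LHS]card_host /M; nia.
exists (SGraph eS eI); split=> //; last first.
  by apply: (host_VC uU cP uK HM ramsey he); case: emax.
apply: min_degree_geq; first by rewrite cardG; nia.
move=> x; apply: (@leq_trans (m + rho * M)); first by rewrite /M; nia.
apply: leq_trans (card_neigh_host U u pI sigmaP x (erefl M)) _.
by apply: subset_leq_card; apply/subsetP => y; rewrite !inE; apply: he.
Qed.

Import Order.TTheory GRing.Theory Num.Theory.
Local Open Scope ring_scope.

Lemma delta_VC_geq (R : realType) (H : sgraph) (q : R) :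
  (forall gamma, 0 <= gamma -> gamma < q -> forall C, exists G : sgraph,
    [/\ maximal_free H G, gamma * #|G|%:R <= (min_degree G)%:R
      & (C < VC G)%N]) ->
  q <= delta_VC R H.
Proof.
move=> hq; apply: lb_le_inf; first by case: (has_inf_VC_bounding R H).
move=> gamma [gamma0 [C hC]]; rewrite leNgt; apply/negP => lt.
have [G [Gmax Gdeg]] := hq gamma gamma0 lt C.
by rewrite ltnNge (hC G Gmax Gdeg).
Qed.

Theorem theorem1p5 (R : realType) (H : sgraph) (r : nat)
  (hr : chromatic_number H = r) (r_ge3 : (3 <= r)%N) :
  let v : R := #|H|%:R in
  let q : R := ((r%:R - 3) * (v - 1) + 1) / ((r%:R - 2) * (v - 1) + 1) in
  delta_VC R H >= q /\ q > (r%:R - 3) / (r%:R - 2).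
Proof.
have [rho rE] : exists rho, r = rho.+3 by exists (r - 3)%N; rewrite -addn3 subnK.
have nH : ~~ colorable H rho.+2.
  apply/negP => cH; move: hr; rewrite /chromatic_number rE.
  by case: ex_minnP => k _ /(_ _ cH) + ke; rewrite ke ltnn.
have H0 : (0 < #|H|)%N.
  have [_ [_ [_ [u _]]]] := extremal_deletion nH.
  by apply/card_gt0P; exists u.
move=> v q; pose D : R := (rho * #|H|.-1).+1%:R.
pose E : R := (#|H| + rho * #|H|.-1)%:R.
have E0 : 0 < E by rewrite ltr0n addn_gt0 H0.
have vE : v = #|H|.-1%:R + 1 by rewrite natr1 prednK.
have rR : r%:R = rho%:R + 3 :> R by rewrite rE -addn3 natrD.
have qE : q = D / E.
  rewrite /q /D /E -addn1 !natrD !natrM rR -/v vE.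
  by congr (_ / _); ring.
split.
  apply: delta_VC_geq => gamma gamma0 lt C.
  have [k hk] := maximal_free_large_VC C nH.
  have gap : 0 < D - gamma * E.
    by rewrite subr_gt0 -ltr_pdivlMr // -qE.
  (* Large enough for [gamma * (k + m * E) <= m * D]; the two successors ensure [1 < m]. *)
  pose m := (Num.bound (gamma * k%:R / (D - gamma * E))).+2.
  have [G [Gmax Gcard Gdeg GVC]] := hk m isT.
  exists G; split=> //; apply: le_trans (_ : (m * (rho * #|H|.-1).+1)%:R <= _).
    rewrite Gcard natrD !natrM -/D -/E.
    have : gamma * k%:R <= m%:R * (D - gamma * E).
      rewrite -ler_pdivrMr //.
      apply: (@le_trans _ _ (Num.bound (gamma * k%:R / (D - gamma * E)))%:R).
        by apply/ltW/archi_boundP; rewrite divr_ge0 ?mulr_ge0 // ltW.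
      by rewrite ler_nat /m; lia.
    by lra.
  by rewrite ler_nat.
have r2 : 0 < r%:R - 2 :> R by rewrite rR; have := ler0n R rho; lra.
(* After cross-multiplication the two sides differ by exactly 1. *)
rewrite qE ltr_pdivrMr // mulrAC ltr_pdivlMr // /D /E rR -addn1.
rewrite !natrD !natrM -/v vE.
by lra.
Qed.
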